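(* Let $G$ be a finite group and $U:g\mapsto U_g$ a unitary representation of $G$ on $\mathcal{H}_d=\mathbb{C}^d$. Suppose $r$ is a positive integer and $|\psi\rangle\in\mathcal{H}_d^{\otimes r}$ is a state such that the vectors $|\psi(g)\rangle:=U_g^{\otimes r}|\psi\rangle$, $g\in G$, satisfy $\langle\psi(g)|\psi(h)\rangle=\delta_{g,h}$ and $U_h^{\otimes r}|\psi(g)\rangle=|\psi(hg)\rangle$ for all $g,h\in G$. For every positive integer $m$ and every state $|\phi\rangle\in\mathcal{H}_d^{\otimes m}$ define $$|\chi_\phi\rangle=\frac{1}{\sqrt{|G|}}\sum_{g\in G}|\psi(g)\rangle\otimes U_g^{\otimes m}|\phi\rangle\in\mathcal{H}_d^{\otimes(r+m)}.$$ Then: (a) $|\chi_\phi\rangle$ is a state and $U_h^{\otimes(r+m)}|\chi_\phi\rangle=|\chi_\phi\rangle$ for all $h\in G$. Consequently $\mathcal{E}_p(|\chi_\phi\rangle\langle\chi_\phi|)=|\chi_\phi\rangle\langle\chi_\phi|$ for every probability distribution $p=(p_g)_{g\in G}$ on $G$, where $\mathcal{E}_p(\rho)=\sum_{g\in G}p_g\,U_g^{\otimes(r+m)}\rho\,(U_g^{\otimes(r+m)})^\dagger$. (b) If the first $r$ qudits of $|\chi_\phi\rangle$ are measured with the projective measurement $\{A_g=|\psi(g)\rangle\langle\psi(g)|\}_{g\in G}\cup\{A_\perp=I-\sum_{g\in G}A_g\}$, then the outcome $\perp$ has probability zero, and upon obtaining outcome $g\in G$, applying $U_{g^{-1}}^{\otimes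 m}$ to the remaining $m$ qudits leaves them exactly in the state $|\phi\rangle$.
   Context: A state is a unit vector; a qudit is a system with Hilbert space $\mathbb{C}^d$. *)

(* Defs.v *)
From mathcomp Require Import all_boot all_order all_fingroup all_algebra.
From mathcomp Require Import mxrepresentation spectral complex mxtens reals.

Set Implicit Arguments.
Unset Strict Implicit.
Unset Printing Implicit Defensive.

Import GRing.Theory Num.Theory.
Local Open Scope ring_scope.
Local Open Scope complex_scope.

(* Kets are column vectors over R[i].  The n-qudit space (C^d)^(⊗n) is
   'cV[R[i]]_(d ^ n), the tensor product being the Kronecker product [tensmx],
   and A^(⊗n) being [ntensmx A n]. *)

Definition adjoint (R : realType) (m n : nat) (A : 'M[R[i]]_(m, n)) :
  'M[R[i]]_(n, m) := map_mx Num.conj A^T.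

Definition braket (R : realType) (n : nat) (u v : 'cV[R[i]]_n) : R[i] :=
  (adjoint u *m v) 0 0.

Definition ketbra (R : realType) (n : nat) (u v : 'cV[R[i]]_n) : 'M[R[i]]_n :=
  u *m adjoint v.

Definition vnorm (R : realType) (n : nat) (u : 'cV[R[i]]_n) : R[i] :=
  sqrtC (braket u u).

Definition is_state (R : realType) (n : nat) (u : 'cV[R[i]]_n) : Prop :=
  vnorm u = 1.

(* The casts below identify d ^ r * d ^ m with d ^ (r + m); since
   [mxtens_index] is row-major, this is the identification
   H^(⊗r) ⊗ H^(⊗m) = H^(⊗(r+m)) sending a basis vector indexed by a pair of
   multi-indices to the one indexed by their concatenation. *)

Definition tens_ket (R : realType) (d r m : nat)
    (u : 'cV[R[i]]_(d ^ r)) (v : 'cV[R[i]]_(d ^ m)) : 'cV[R[i]]_(d ^ (r + m)) :=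
  castmx (esym (expnD d r m), erefl 1%N) (tensmx u v).

Definition tens_op (R : realType) (d r m : nat)
    (A : 'M[R[i]]_(d ^ r)) (B : 'M[R[i]]_(d ^ m)) : 'M[R[i]]_(d ^ (r + m)) :=
  castmx (esym (expnD d r m), esym (expnD d r m)) (tensmx A B).

Definition split_index (d r m : nat) (k : 'I_(d ^ r)) (i : 'I_(d ^ m)) :
  'I_(d ^ (r + m)) := cast_ord (esym (expnD d r m)) (mxtens_index (k, i)).

(* Partial trace over the first r qudits: the density operator of the
   remaining m qudits. *)
Definition partial_trace (R : realType) (d r m : nat)
    (rho : 'M[R[i]]_(d ^ (r + m))) : 'M[R[i]]_(d ^ m) :=
  \matrix_(i, j) \sum_(k < d ^ r) rho (split_index k i) (split_index k j).
Arguments partial_trace {R} d r m rho.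

Definition projective_measurement (R : realType) (n : nat) (O : finType)
    (A : O -> 'M[R[i]]_n) : Prop :=
  [/\ forall o, adjoint (A o) = A o,
      forall o, A o *m A o = A o,
      forall o o', o != o' -> A o *m A o' = 0
    & \sum_o A o = 1%:M].

(* Born rule, for the projector P attached to an outcome. *)
Definition outcome_prob (R : realType) (n : nat) (P : 'M[R[i]]_n)
    (u : 'cV[R[i]]_n) : R[i] := braket u (P *m u).

(* Meaningful when the outcome has nonzero probability (the zero vector
   otherwise, as 0^-1 = 0). *)
Definition post_state (R : realType) (n : nat) (P : 'M[R[i]]_n)
    (u : 'cV[R[i]]_n) : 'cV[R[i]]_n :=
  (sqrtC (outcome_prob P u))^-1 *: (P *m u).

Definition translate (R : realType) (G : finGroupType) (d : nat)
    (U : G -> 'M[R[i]]_d) (r : nat) (psi : 'cV[R[i]]_(d ^ r)) (g : G) :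
  'cV[R[i]]_(d ^ r) := ntensmx (U g) r *m psi.

Definition chi (R : realType) (G : finGroupType) (d : nat)
    (U : G -> 'M[R[i]]_d) (r : nat) (psi : 'cV[R[i]]_(d ^ r))
    (m : nat) (phi : 'cV[R[i]]_(d ^ m)) : 'cV[R[i]]_(d ^ (r + m)) :=
  (sqrtC #|G|%:R)^-1 *:
    \sum_(g : G) tens_ket (translate U psi g) (ntensmx (U g) m *m phi).

Definition prob_distr (R : realType) (G : finType) (p : G -> R) : Prop :=
  (forall g, 0 <= p g) /\ \sum_g p g = 1.

Definition twirl (R : realType) (G : finGroupType) (d : nat)
    (U : G -> 'M[R[i]]_d) (n : nat) (p : G -> R) (rho : 'M[R[i]]_(d ^ n)) :
  'M[R[i]]_(d ^ n) :=
  \sum_(g : G)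
    (p g)%:C *: (ntensmx (U g) n *m rho *m adjoint (ntensmx (U g) n)).

(* The outcome [Some g] stands for g, and [None] for ⊥. *)
Definition meas (R : realType) (G : finGroupType) (d : nat)
    (U : G -> 'M[R[i]]_d) (r : nat) (psi : 'cV[R[i]]_(d ^ r)) (o : option G) :
  'M[R[i]]_(d ^ r) :=
  if o is Some g then ketbra (translate U psi g) (translate U psi g)
  else 1%:M - \sum_(g : G) ketbra (translate U psi g) (translate U psi g).

Definition on_first (R : realType) (d r m : nat) (A : 'M[R[i]]_(d ^ r)) :
  'M[R[i]]_(d ^ (r + m)) := tens_op A (1%:M : 'M[R[i]]_(d ^ m)).
Arguments on_first {R d r} m A.

Definition on_last (R : realType) (d r m : nat) (B : 'M[R[i]]_(d ^ m)) :
  'M[R[i]]_(d ^ (r + m)) := tens_op (1%:M : 'M[R[i]]_(d ^ r)) B.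
Arguments on_last {R d} r {m} B.

(* Main.v *)
Require Import Defs.
From mathcomp Require Import all_boot all_order all_fingroup all_algebra.
From mathcomp Require Import mxrepresentation spectral complex mxtens reals.

Set Implicit Arguments.
Unset Strict Implicit.
Unset Printing Implicit Defensive.

Import GRing.Theory Num.Theory.
Local Open Scope ring_scope.
Local Open Scope complex_scope.

(* The action of h permutes the summands of chi through g |-> hg, which gives
   the invariance.  Since the psi(g) are orthonormal, A_g kills every summand
   of chi except the one indexed by g, so each outcome g has probability
   1/|G| and leaves exactly psi(g) ⊗ U_g phi. *)

(** * Kronecker powers, up to casts between equal dimensions *)

Section TensorCasts.
Variable R : comPzRingType.

Lemma tensmx_castr m n p q p' q' (ep : p = p') (eq : q = q')
    (A : 'M[R]_(m, n)) (B : 'M[R]_(p, q)) :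
  tensmx A (castmx (ep, eq) B) =
  castmx (congr1 (muln m) ep, congr1 (muln n) eq) (tensmx A B).
Proof. by case: p' / ep; case: q' / eq; rewrite !castmx_id. Qed.

Lemma tensmx_castl m n p q m' n' (em : m = m') (en : n = n')
    (A : 'M[R]_(m, n)) (B : 'M[R]_(p, q)) :
  tensmx (castmx (em, en) A) B =
  castmx (congr1 (muln^~ p) em, congr1 (muln^~ q) en) (tensmx A B).
Proof. by case: m' / em; case: n' / en; rewrite !castmx_id. Qed.

(** In row-major order both bracketings flatten (x, y, z) to the same number, (xb + y)c + z = x(bc)
    + (yc + z), so the cast only relabels the dimensions. *)
Lemma tensmxA m n p q s t
    (A : 'M[R]_(m, n)) (B : 'M[R]_(p, q)) (C : 'M[R]_(s, t)) :
  tensmx (tensmx A B) C =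
  castmx (mulnA m p s, mulnA n q t) (tensmx A (tensmx B C)).
Proof.
apply/matrixP=> i j.
case: (mxtens_indexP i) => i12 i3; case: (mxtens_indexP i12) => i1 i2.
case: (mxtens_indexP j) => j12 j3; case: (mxtens_indexP j12) => j1 j2.
have assocI a b c (x : 'I_a) (y : 'I_b) (z : 'I_c) :
    cast_ord (esym (mulnA a b c)) (mxtens_index (mxtens_index (x, y), z)) =
    mxtens_index (x, mxtens_index (y, z)).
  by apply: val_inj; rewrite /= mulnDl mulnA addnA.
by rewrite castmxE /= !assocI !tensmxE mulrA.
Qed.

(** [ntensmx A 1] is [A] itself, with no trailing trivial factor, so [ntensmxSS] starts at exponent
    two. This recursion, valid for every [k], is what the induction in [ntensmxD] needs. *)
Lemma ntensmxS m n (A : 'M[R]_(m, n)) k :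
  ntensmx A k.+1 =
  castmx (esym (expnS m k), esym (expnS n k)) (tensmx A (ntensmx A k)).
Proof.
case: k => [|k]; last by rewrite ntensmxSS castmx_id.
have -> : ntensmx A 0 = 1%:M by [].
(* Tensoring with the 1 by 1 identity is a cast; the composite cast has convertible endpoints and
   vanishes. *)
rewrite tens_mx_scalar scale1r castmx_comp.
by rewrite [LHS](_ : _ = A) // castmx_id.
Qed.

(** This exhibits the action on r + s qudits as a [tens_op], so that it can act on each tensor
    factor separately. *)
Lemma ntensmxD m n (A : 'M[R]_(m, n)) r s :
  ntensmx A (r + s) =
  castmx (esym (expnD m r s), esym (expnD n r s))
    (tensmx (ntensmx A r) (ntensmx A s)).
Proof.
elim: r => [|r IHr].
  have -> : ntensmx A 0 = 1 by [].
  rewrite tens_scalar1mx castmx_comp.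
  by apply/matrixP=> i j; rewrite castmxE; congr (_ _ _); exact: val_inj.
rewrite [LHS](ntensmxS A (r + s)) ntensmxS IHr tensmx_castr tensmx_castl.
rewrite tensmxA !castmx_comp.
(* Both sides are now casts of one matrix, and any two proofs of an equality in [nat] agree. *)
by congr (castmx (_, _)); exact: nat_irrelevance.
Qed.

Lemma ntensmx_mul m n p (A : 'M[R]_(m, n)) (B : 'M[R]_(n, p)) k :
  ntensmx (A *m B) k = ntensmx A k *m ntensmx B k.
Proof.
elim: k => [|[|k] IHk] //; first by rewrite mulmx1.
by rewrite !ntensmxSS IHk tensmx_mul.
Qed.

Lemma tens1mx1 m n : tensmx (1%:M : 'M[R]_m) (1%:M : 'M[R]_n) = 1%:M.
Proof.
apply/matrixP=> i j.
case: (mxtens_indexP i) => i1 i2; case: (mxtens_indexP j) => j1 j2.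
rewrite tensmxE !mxE -natrM mulnb.
(* Encoding pairs is injective, so the delta on codes is the product of the two deltas. *)
by rewrite (can_eq (@mxtens_indexK m n)) xpair_eqE.
Qed.

Lemma ntensmx1M m k : ntensmx (1%:M : 'M[R]_m) k = 1%:M.
Proof. by elim: k => [|[|k] IHk] //; rewrite ntensmxSS IHk tens1mx1. Qed.

End TensorCasts.

(** * Adjoints, inner products and rank-one operators *)

Section Kets.
Variable R : realType.
Local Notation C := R[i].

Lemma adjointM m n p (A : 'M[C]_(m, n)) (B : 'M[C]_(n, p)) :
  adjoint (A *m B) = adjoint B *m adjoint A.
Proof. by rewrite /adjoint trmx_mul map_mxM. Qed.

Lemma adjointK m n (A : 'M[C]_(m, n)) : adjoint (adjoint A) = A.
Proof. by apply/matrixP=> i j; rewrite !mxE conjCK. Qed.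

Lemma adjointB m n (A B : 'M[C]_(m, n)) :
  adjoint (A - B) = adjoint A - adjoint B.
Proof. by apply/matrixP=> i j; rewrite !mxE rmorphB. Qed.

Lemma adjointZ m n a (A : 'M[C]_(m, n)) :
  adjoint (a *: A) = Num.conj a *: adjoint A.
Proof. by apply/matrixP=> i j; rewrite !mxE rmorphM. Qed.

Lemma adjoint1 n : adjoint (1%:M : 'M[C]_n) = 1%:M.
Proof. by rewrite /adjoint trmx1 map_mx1. Qed.

Lemma adjoint_sum m n (I : finType) (F : I -> 'M[C]_(m, n)) :
  adjoint (\sum_i F i) = \sum_i adjoint (F i).
Proof.
apply/matrixP=> i j; rewrite !mxE !summxE rmorph_sum.
by apply: eq_bigr => k _; rewrite !mxE.
Qed.

Lemma adjoint_tens m n p q (A : 'M[C]_(m, n)) (B : 'M[C]_(p, q)) :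
  adjoint (tensmx A B) = tensmx (adjoint A) (adjoint B).
Proof. by rewrite /adjoint trmx_tens map_mxT. Qed.

Lemma adjoint_ntens m n (A : 'M[C]_(m, n)) k :
  adjoint (ntensmx A k) = ntensmx (adjoint A) k.
Proof.
elim: k => [|[|k] IHk] //; first exact: adjoint1.
by rewrite !ntensmxSS adjoint_tens IHk.
Qed.

Lemma adjoint_ketbra n (u v : 'cV[C]_n) : adjoint (ketbra u v) = ketbra v u.
Proof. by rewrite /ketbra adjointM adjointK. Qed.

Lemma mul_ketbra n (u v w : 'cV[C]_n) : ketbra u v *m w = braket v w *: u.
Proof. by rewrite /ketbra -mulmxA [adjoint v *m w]mx11_scalar mul_mx_scalar. Qed.

Lemma ketbraMl n p (A : 'M[C]_(p, n)) (u v : 'cV[C]_n) :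
  ketbra (A *m u) (A *m v) = A *m ketbra u v *m adjoint A.
Proof. by rewrite /ketbra adjointM !mulmxA. Qed.

Lemma braketZl n a (u v : 'cV[C]_n) :
  braket (a *: u) v = Num.conj a * braket u v.
Proof. by rewrite /braket adjointZ -scalemxAl mxE. Qed.

Lemma braketZr n a (u v : 'cV[C]_n) : braket u (a *: v) = a * braket u v.
Proof. by rewrite /braket -scalemxAr mxE. Qed.

Lemma braket0r n (u : 'cV[C]_n) : braket u 0 = 0.
Proof. by rewrite /braket mulmx0 mxE. Qed.

Lemma braket_suml n (I : finType) (F : I -> 'cV[C]_n) v :
  braket (\sum_i F i) v = \sum_i braket (F i) v.
Proof. by rewrite /braket adjoint_sum mulmx_suml summxE. Qed.

Lemma braket_sumr n (I : finType) u (F : I -> 'cV[C]_n) :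
  braket u (\sum_i F i) = \sum_i braket u (F i).
Proof. by rewrite /braket mulmx_sumr summxE. Qed.

Lemma braketE n (u v : 'cV[C]_n) :
  braket u v = \sum_k Num.conj (u k 0) * v k 0.
Proof. by rewrite /braket mxE; apply: eq_bigr => k _; rewrite !mxE. Qed.

Lemma is_stateP n (u : 'cV[C]_n) : is_state u <-> braket u u = 1.
Proof.
rewrite /is_state /vnorm; split=> [h|->]; last exact: sqrtC1.
by rewrite -[LHS]sqrtCK h expr1n.
Qed.

Lemma braket_isometry m n (A : 'M[C]_(m, n)) (u v : 'cV[C]_n) :
  adjoint A *m A = 1%:M -> braket (A *m u) (A *m v) = braket u v.
Proof. by move=> AA; rewrite /braket adjointM mulmxA -[_ *m A]mulmxA AA mulmx1. Qed.

Lemma ntens_unitary n (A : 'M[C]_n) k :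
  A \is unitarymx -> adjoint (ntensmx A k) *m ntensmx A k = 1%:M.
Proof.
move=> /unitarymxP AA; rewrite adjoint_ntens -ntensmx_mul.
(* Unitarity is given as A A* = 1; for a square matrix a one-sided inverse is two-sided. *)
by rewrite (_ : adjoint A *m A = 1%:M) ?ntensmx1M //; exact: mulmx1C.
Qed.

(** * Product kets on the first r and last m qudits *)

Section Bipartite.
Variables d r m : nat.
Implicit Types (u a : 'cV[C]_(d ^ r)) (v b : 'cV[C]_(d ^ m)).

Lemma tens_ketE u v k i :
  tens_ket u v (split_index k i) 0 = u k 0 * v i 0.
Proof.
rewrite castmxE /= (_ : cast_ord _ _ = mxtens_index (k, i)); last exact: val_inj.
rewrite mxE mxtens_indexK /=.
by congr (u _ _ * v _ _); apply: ord1.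
Qed.

Lemma tens_op_ket (A : 'M[C]_(d ^ r)) (B : 'M[C]_(d ^ m)) u v :
  tens_op A B *m tens_ket u v = tens_ket (A *m u) (B *m v).
Proof.
rewrite /tens_op /tens_ket mulmx_cast castmx_comp.
(* The cast of the ket has moved onto the columns of the operator, where it cancels the cast already
   there. *)
rewrite -tensmx_mul [in RHS]castmx_mul; congr (_ *m _).
  by congr (castmx (_, _) _); exact: nat_irrelevance.
Qed.

Lemma tens_ketZl c u v : tens_ket (c *: u) v = c *: tens_ket u v.
Proof.
apply/matrixP=> i j; rewrite !(castmxE, mxE) /=.
by rewrite mulrA.
Qed.

Lemma tens_ket0l v : tens_ket (0 : 'cV[C]_(d ^ r)) v = 0.
Proof. by rewrite -[0](scale0r 0) tens_ketZl scale0r. Qed.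

Lemma partial_trace_tens_ket u v :
  partial_trace d r m (ketbra (tens_ket u v) (tens_ket u v)) =
  braket u u *: ketbra v v.
Proof.
apply/matrixP=> i j; rewrite mxE mxE braketE mulr_suml.
apply: eq_bigr => k _; rewrite !mxE !big_ord1 !mxE !tens_ketE rmorphM /=.
by rewrite mulrACA [u k 0 * _]mulrC.
Qed.

Lemma braket_tens_ket u v a b :
  braket (tens_ket u v) (tens_ket a b) = braket u a * braket v b.
Proof.
rewrite !braketE mulr_sum.
(* [mulr_sum] has turned the product of sums into one sum over pair codes; reindexing brings the
   other side to the same range. *)
rewrite (reindex (cast_ord (esym (expnD d r m)))); last first.
  by exists (cast_ord (expnD d r m)) => ? _; rewrite ?cast_ordK ?cast_ordKV.
apply: eq_bigr => k _; case: (mxtens_indexP k) => x y.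
by rewrite mxtens_indexK !tens_ketE rmorphM mulrACA.
Qed.

End Bipartite.
End Kets.

(** * Projectors onto an orthonormal family and onto its span *)

Section OrthonormalFamily.
Variables (R : realType) (I : finType) (n : nat) (e : I -> 'cV[R[i]]_n).
Hypothesis e_on : forall i j, braket (e i) (e j) = (i == j)%:R.

Lemma mul_orthonormal_projectors i j :
  ketbra (e i) (e i) *m ketbra (e j) (e j) =
  (i == j)%:R *: ketbra (e i) (e i).
Proof.
rewrite {2}/ketbra mulmxA mul_ketbra e_on -scalemxAl.
by case: eqP => [->|_]; rewrite ?scale0r.
Qed.

Lemma sum_projectors_orthonormal j :
  (\sum_i ketbra (e i) (e i)) *m e j = e j.
Proof.
rewrite mulmx_suml (bigD1 j) //= mul_ketbra e_on eqxx scale1r.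
by rewrite big1 ?addr0 // => i /negPf ij; rewrite mul_ketbra e_on ij scale0r.
Qed.

Lemma sum_projectors_mull j :
  (\sum_i ketbra (e i) (e i)) *m ketbra (e j) (e j) = ketbra (e j) (e j).
Proof. by rewrite {2}/ketbra mulmxA sum_projectors_orthonormal. Qed.

Lemma sum_projectors_mulr j :
  ketbra (e j) (e j) *m (\sum_i ketbra (e i) (e i)) = ketbra (e j) (e j).
Proof.
(* Taking adjoints swaps the factors and fixes each projector, which reduces this to left
   absorption. *)
apply: (can_inj (@adjointK R n n)); rewrite adjointM adjoint_sum.
under eq_bigr do rewrite adjoint_ketbra.
by rewrite adjoint_ketbra sum_projectors_mull.
Qed.

Lemma sum_projectors_idem :
  (\sum_i ketbra (e i) (e i)) *m (\sum_i ketbra (e i) (e i)) =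
  \sum_i ketbra (e i) (e i).
Proof.
by rewrite mulmx_sumr; apply: eq_bigr => j _; rewrite sum_projectors_mull.
Qed.

Lemma adjoint_sum_projectors :
  adjoint (\sum_i ketbra (e i) (e i)) = \sum_i ketbra (e i) (e i).
Proof. by rewrite adjoint_sum; apply: eq_bigr => i _; exact: adjoint_ketbra. Qed.

End OrthonormalFamily.

(** * The measurement attached to the orbit of [psi] *)

Section Encoding.
Variables (R : realType) (G : finGroupType) (d : nat).
Variable U : mx_representation R[i] [set: G] d.
Hypothesis U_unitary : forall g : G, U g \is unitarymx.
Variables (r : nat) (psi : 'cV[R[i]]_(d ^ r)).
Hypothesis psi_on : forall g h : G,
  braket (translate U psi g) (translate U psi h) = (g == h)%:R.

Lemma ntens_repr k g h (v : 'cV[R[i]]_(d ^ k)) :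
  ntensmx (U g) k *m (ntensmx (U h) k *m v) = ntensmx (U (g * h)%g) k *m v.
Proof. by rewrite mulmxA -ntensmx_mul -repr_mxM ?inE. Qed.

Lemma ntens_repr_invK k g (v : 'cV[R[i]]_(d ^ k)) :
  ntensmx (U g^-1%g) k *m (ntensmx (U g) k *m v) = v.
Proof. by rewrite ntens_repr mulVg repr_mx1 ntensmx1M mul1mx. Qed.

(** The sum S of the rank-one projectors is a self-adjoint idempotent that absorbs each of them on
    either side. Hence 1 - S is a projector orthogonal to all of them, and it completes the sum to
    1. *)
Lemma meas_projective : projective_measurement (meas U psi).
Proof.
split.
- case=> [g|] /=; first exact: adjoint_ketbra.
  by rewrite adjointB adjoint1 adjoint_sum_projectors.
- case=> [g|] /=; first by rewrite mul_orthonormal_projectors // eqxx scale1r.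
  by rewrite mulmxBl mul1mx mulmxBr mulmx1 sum_projectors_idem // subrr subr0.
- case=> [g|] [h|] //= gh.
  + rewrite mul_orthonormal_projectors // (_ : g == h = false) ?scale0r //.
    by apply: contra_neqF gh => /eqP ->.
  + by rewrite mulmxBr mulmx1 sum_projectors_mulr // subrr.
  + by rewrite mulmxBl mul1mx sum_projectors_mull // subrr.
(* Once [None] is split off, the remaining outcomes are reindexed by the group through [Some]. *)
- rewrite (bigD1 None) //= (reindex_omap Some id) /=; last by case.
  under [X in _ + X]eq_bigl do rewrite eqxx.
  by rewrite subrK.
Qed.

(** * The encoded state and its measurement outcomes *)

Section Message.
Import Order.POrderTheory.
Variables (m : nat) (phi : 'cV[R[i]]_(d ^ m)).
Hypothesis phi_state : is_state phi.

(** The prefactor of [chi]. Being positive, it is fixed by conjugation, is invertible, and is the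
    principal square root of its square 1/|G|. *)
Let norm_factor : R[i] := (sqrtC #|G|%:R)^-1.

Let card_gt0 : 0 < #|G|%:R :> R[i].
Proof. by rewrite ltr0n; apply/card_gt0P; exists 1%g. Qed.

Let norm_factor_gt0 : 0 < norm_factor.
Proof. by rewrite invr_gt0 sqrtC_gt0. Qed.

Let norm_factor_sqr : norm_factor * norm_factor = #|G|%:R^-1.
Proof. by rewrite -invfM -expr2 sqrtCK. Qed.

Let conj_norm_factor : Num.conj norm_factor = norm_factor.
Proof. by rewrite geC0_conj // ltW. Qed.

Lemma braket_ntens_repr g :
  braket (ntensmx (U g) m *m phi) (ntensmx (U g) m *m phi) = 1.
Proof. by rewrite braket_isometry ?ntens_unitary //; apply/is_stateP. Qed.

(** Orthonormality of the first factors leaves only the diagonal of the double sum: |G| terms equal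
    to 1, against the squared prefactor 1/|G|. *)
Lemma chi_state : is_state (chi U psi phi).
Proof.
apply/is_stateP; rewrite braketZl braketZr mulrA conj_norm_factor norm_factor_sqr.
rewrite braket_suml (eq_bigr (fun=> 1)) => [|g _].
  by rewrite sumr_const mulVf // gt_eqF.
rewrite braket_sumr (bigD1 g) //= braket_tens_ket psi_on eqxx braket_ntens_repr.
rewrite mulr1 big1 ?addr0 // => h gh.
by rewrite braket_tens_ket psi_on eq_sym (negPf gh) mul0r.
Qed.

Lemma chi_invariant h : ntensmx (U h) (r + m) *m chi U psi phi = chi U psi phi.
Proof.
rewrite /chi -scalemxAr mulmx_sumr; congr (_ *: _).
(* The shift is made on the right-hand side; the summands then match by multiplicativity of U on
   each factor. *)
rewrite [RHS](reindex_inj (mulgI h)); apply: eq_bigr => g _.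
by rewrite ntensmxD [LHS]tens_op_ket /translate !ntens_repr.
Qed.

(** The first factor of every summand lies in the span of the orbit, on which the complementary
    projector vanishes. *)
Lemma on_first_none_chi : on_first m (meas U psi None) *m chi U psi phi = 0.
Proof.
rewrite -scalemxAr mulmx_sumr big1 ?scaler0 // => g _.
rewrite tens_op_ket /= mulmxBl !mul1mx.
by rewrite (sum_projectors_orthonormal psi_on) subrr tens_ket0l.
Qed.

Lemma on_first_some_chi g :
  on_first m (meas U psi (Some g)) *m chi U psi phi =
  norm_factor *: tens_ket (translate U psi g) (ntensmx (U g) m *m phi).
Proof.
rewrite -scalemxAr mulmx_sumr (bigD1 g) //= big1 => [|h hg].
  by rewrite addr0 tens_op_ket mul_ketbra psi_on eqxx scale1r mul1mx.
by rewrite tens_op_ket mul_ketbra psi_on eq_sym (negPf hg) scale0r tens_ket0l.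
Qed.

Lemma outcome_prob_some g :
  outcome_prob (on_first m (meas U psi (Some g))) (chi U psi phi) = #|G|%:R^-1.
Proof.
rewrite /outcome_prob on_first_some_chi braketZr braketZl conj_norm_factor.
rewrite braket_suml (bigD1 g) //= braket_tens_ket psi_on eqxx braket_ntens_repr.
rewrite big1 ?addr0 => [|h gh]; first by rewrite !mulr1 norm_factor_sqr.
by rewrite braket_tens_ket psi_on (negPf gh) mul0r.
Qed.

Lemma post_state_some g :
  post_state (on_first m (meas U psi (Some g))) (chi U psi phi) =
  tens_ket (translate U psi g) (ntensmx (U g) m *m phi).
Proof.
rewrite /post_state outcome_prob_some on_first_some_chi scalerA.
(* The root of the probability is exactly the prefactor left by the projection. It is nonzero, so
   the default value of the inverse does not intervene. *)
rewrite -norm_factor_sqr -expr2 sqrCK ?ltW // mulVf ?scale1r //.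
by rewrite gt_eqF.
Qed.

End Message.
End Encoding.

Theorem mainTheorem2 (R : realType) (G : finGroupType) (d : nat)
    (U : mx_representation R[i] [set: G] d)
    (U_unitary : forall g : G, U g \is unitarymx)
    (r : nat) (r_gt0 : (0 < r)%N)
    (psi : 'cV[R[i]]_(d ^ r)) (psi_state : is_state psi)
    (psi_orthonormal : forall g h : G,
       braket (translate U psi g) (translate U psi h) = (g == h)%:R)
    (psi_covariant : forall g h : G,
       ntensmx (U h) r *m translate U psi g = translate U psi (h * g)%g) :
  forall (m : nat) (phi : 'cV[R[i]]_(d ^ m)), (0 < m)%N -> is_state phi ->
    (* (a) *)
    [/\ is_state (chi U psi phi),
        forall h : G,
          ntensmx (U h) (r + m) *m chi U psi phi = chi U psi phi
      & forall p : G -> R, prob_distr p ->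
          twirl U p (ketbra (chi U psi phi) (chi U psi phi)) =
          ketbra (chi U psi phi) (chi U psi phi)]
    /\
    (* (b) *)
    [/\ projective_measurement (meas U psi),
        outcome_prob (on_first m (meas U psi None)) (chi U psi phi) = 0
      & forall g : G,
          let post :=
            on_last r (ntensmx (U (g^-1)%g) m) *m
              post_state (on_first m (meas U psi (Some g))) (chi U psi phi) in
          partial_trace d r m (ketbra post post) = ketbra phi phi].
Proof.
move=> m phi _ phi_state; split; split.
- exact: chi_state.
- exact: chi_invariant.
- move=> p [_ p1]; rewrite /twirl.
  (* Conjugating the projector onto [chi] gives the projector onto the moved vector, which is [chi]
     again; only the total weight 1 remains. *)
  under eq_bigr do rewrite -ketbraMl chi_invariant.
  by rewrite -scaler_suml -rmorph_sum p1 scale1r.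
- exact: meas_projective.
- by rewrite /outcome_prob on_first_none_chi // braket0r.
(* The correction undoes U_g and leaves the product of psi(g) and phi. Tracing out the unit vector
   psi(g) then gives the projector onto phi with coefficient 1. *)
- move=> g /=; rewrite post_state_some // tens_op_ket mul1mx ntens_repr_invK.
  by rewrite partial_trace_tens_ket psi_orthonormal eqxx scale1r.
Qed.
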